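(* Under exactly the hypotheses of the previous setting — $\Phi$ Legendre, twice continuously differentiable on $\operatorname{int}\operatorname{dom}\Phi$ and very strictly convex; $0\le\rho_k\le\rho<1$; $\operatorname{zer}T\cap\operatorname{int}\operatorname{dom}\Phi\ne\emptyset$; $D_\Phi(z^\star,\cdot)$ coercive for some $z^\star\in\operatorname{dom}\Phi\cap\operatorname{zer}T$; and the error bound (EB) holding with constants $\delta,\kappa$ at the limit $z^\infty\in\operatorname{zer}T\cap\operatorname{int}\operatorname{dom}\Phi$ of $z^k$ — there exist $\varepsilon>0$ and constants $\theta>0$, $\Theta<\infty$ (with $B_\varepsilon(z^\infty)\subseteq\operatorname{int}\operatorname{dom}\Phi$, $\|\nabla\Phi(a)-\nabla\Phi(b)\|\le\Theta\|a-b\|$ and $D_\Phi(a,b)\ge\frac\theta2\|a-b\|^2$ on $B_\varepsilon(z^\infty)$) and an index $k_0$ such that for all $k\ge k_0$ $$\operatorname{dist}_\Phi(z^{k+1},\operatorname{zer}T)\le q_k\operatorname{dist}_\Phi(z^k,\operatorname{zer}T),\qquad q_k=\frac{1}{1+\frac{1-\rho_k}{C_k}}\in(0,1),$$ with $C_k=\big(\sqrt{\rho_k}\tfrac{\sqrt\Theta}{\sqrt\theta}+\tfrac{\kappa}{\sigma_k}\Theta(1+\sqrt{\rho_k})\big)^2\tfrac{\Theta}{\theta}$. In particular, if $\sigma_k\to\infty$ and $\rho_k\to0$, then $q_k\to0$, i.e. $\operatorname{dist}_\Phi(z^k,\operatorname{zer}T)$ converges to $0$ superlinearly.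
   Context: Let $\mathbb{E}$ be a finite-dimensional Euclidean space, $\Gamma_0(\mathbb{E})$ the proper lsc convex functions $\mathbb{E}\to\mathbb{R}\cup\{+\infty\}$. $\Phi\in\Gamma_0(\mathbb{E})$ is Legendre if it is essentially smooth ($\operatorname{int}\operatorname{dom}\Phi\ne\emptyset$, differentiable there, $\|\nabla\Phi(z^\nu)\|\to\infty$ whenever $\operatorname{int}\operatorname{dom}\Phi\ni z^\nu\to z\in\operatorname{bdry}\operatorname{dom}\Phi$) and essentially strictly convex (strictly convex on every convex subset of $\operatorname{dom}\partial\Phi$); then $\nabla\Phi:\operatorname{int}\operatorname{dom}\Phi\to\operatorname{int}\operatorname{dom}\Phi^*$ is a bijection with inverse $\nabla\Phi^*$. Very strictly convex means $\nabla^2\Phi(z)\succ0$ for all $z\in\operatorname{int}\operatorname{dom}\Phi$. $D_\Phi(z_1,z_2)=\Phi(z_1)-\Phi(z_2)-\langle\nabla\Phi(z_2),z_1-z_2\rangle$ if $z_1\in\operatorname{dom}\Phi$, $z_2\in\operatorname{int}\operatorname{dom}\Phi$, and $+\infty$ otherwise. For a closed convex set $Z$, $\operatorname{dist}_\Phi(y,Z)=\inf_{x\in Z}D_\Phi(x,y)$; $\operatorname{dist}(z,Z)$ is the Euclidean distance; $B_\varepsilon(z)$ is the closed Euclidean ball. Let $T:\mathbb{E}\rightrightarrows\mathbb{E}$ be maximal monotone, $\operatorname{zer}T=T^{-1}(0)$, and assume $\operatorname{int}\operatorname{dom}\Phi\cap\operatorname{dom}T\ne\emptyset$. Inexact Bregman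 proximal point algorithm: given $z^0\in\operatorname{int}\operatorname{dom}\Phi$, step sizes $\sigma_k\ge\sigma>0$ and tolerances $\rho_k\in[0,1)$, it generates triples $(z^{k+1},p^k,w^k)$ with $p^k\in\operatorname{dom}\Phi$, $w^k\in T(p^k)$, $\nabla\Phi(z^k)-\sigma_kw^k\in\operatorname{int}\operatorname{dom}\Phi^*$, $z^{k+1}=\nabla\Phi^*(\nabla\Phi(z^k)-\sigma_kw^k)\in\operatorname{int}\operatorname{dom}\Phi$, and $D_\Phi(p^k,z^{k+1})\le\rho_kD_\Phi(p^k,z^k)$. Error bound condition (EB) at $\bar z\in\operatorname{zer}T$: there exist $\delta,\kappa>0$ such that whenever $w\in T(z)$, $\|z-\bar z\|\le\delta$, $\|w\|\le\delta$, then $\operatorname{dist}(z,\operatorname{zer}T)\le\kappa\|w\|$. A function $h$ is coercive if $h(z)\to\infty$ as $\|z\|\to\infty$. *)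

(* Defs.v *)
From HB Require Import structures.
From mathcomp Require Import all_boot all_order all_algebra.
From mathcomp Require Import all_classical all_reals all_analysis.
Set Implicit Arguments. Unset Strict Implicit. Unset Printing Implicit Defensive.
Import Order.TTheory GRing.Theory Num.Theory.
Import numFieldNormedType.Exports.
Local Open Scope classical_set_scope.
Local Open Scope ring_scope.

Definition dot {R : realType} {n : nat} (u v : 'rV[R]_n) : R :=
  \sum_(i < n) u 0 i * v 0 i.
Definition enorm {R : realType} {n : nat} (u : 'rV[R]_n) : R :=
  Num.sqrt (dot u u).

Definition eball {R : realType} {n : nat} (c : 'rV[R]_n) (e : R) : set 'rV[R]_n :=
  [set z | enorm (z - c) <= e].

Definition partial {R : realType} {n : nat} (i : 'I_n) (f : 'rV[R]_n -> R)
  : 'rV[R]_n -> R := fun z => derive f z (delta_mx 0 i).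
Definition grad {R : realType} {n : nat} (f : 'rV[R]_n -> R) (z : 'rV[R]_n)
  : 'rV[R]_n := \row_i partial i f z.
Definition hessian {R : realType} {n : nat} (f : 'rV[R]_n -> R) (z : 'rV[R]_n)
  : 'M[R]_n := \matrix_(i, j) partial j (partial i f) z.

Definition edom {R : realType} {n : nat} (Phi : 'rV[R]_n -> \bar R) : set 'rV[R]_n :=
  [set z | (Phi z < +oo)%E].
Definition intdom {R : realType} {n : nat} (Phi : 'rV[R]_n -> \bar R) : set 'rV[R]_n :=
  interior (edom Phi).
Definition bdry {R : realType} {n : nat} (A : set 'rV[R]_n) : set 'rV[R]_n :=
  closure A `\` interior A.
(* finite part, used to differentiate Phi on int dom Phi *)
Definition finPhi {R : realType} {n : nat} (Phi : 'rV[R]_n -> \bar R) : 'rV[R]_n -> R :=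
  fun z => fine (Phi z).
Definition gradPhi {R : realType} {n : nat} (Phi : 'rV[R]_n -> \bar R) :=
  grad (finPhi Phi).

Definition proper_fun {R : realType} {n : nat} (Phi : 'rV[R]_n -> \bar R) : Prop :=
  (forall z, Phi z <> -oo%E) /\ edom Phi !=set0.
Definition convex_fun {R : realType} {n : nat} (Phi : 'rV[R]_n -> \bar R) : Prop :=
  forall (x y : 'rV[R]_n) (t : R), 0 < t < 1 ->
    (Phi (t *: x + (1 - t) *: y)%R <= t%:E * Phi x + (1 - t)%R%:E * Phi y)%E.
Definition Gamma0 {R : realType} {n : nat} (Phi : 'rV[R]_n -> \bar R) : Prop :=
  [/\ proper_fun Phi, lower_semicontinuous Phi & convex_fun Phi].

Definition convex_set {R : realType} {n : nat} (C : set 'rV[R]_n) : Prop :=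
  forall (x y : 'rV[R]_n) (t : R), C x -> C y -> 0 <= t <= 1 -> C (t *: x + (1 - t) *: y).
Definition strictly_convex_on {R : realType} {n : nat}
    (Phi : 'rV[R]_n -> \bar R) (C : set 'rV[R]_n) : Prop :=
  forall (x y : 'rV[R]_n) (t : R), C x -> C y -> x <> y -> 0 < t < 1 ->
    (Phi (t *: x + (1 - t) *: y)%R < t%:E * Phi x + (1 - t)%R%:E * Phi y)%E.

Definition subdiff {R : realType} {n : nat} (Phi : 'rV[R]_n -> \bar R)
    (z : 'rV[R]_n) : set 'rV[R]_n :=
  [set w | Phi z \is a fin_num /\
           forall x, (Phi z + (dot w (x - z))%:E <= Phi x)%E].
Definition dom_subdiff {R : realType} {n : nat} (Phi : 'rV[R]_n -> \bar R)
  : set 'rV[R]_n := [set z | subdiff Phi z !=set0].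

Definition essentially_smooth {R : realType} {n : nat} (Phi : 'rV[R]_n -> \bar R)
  : Prop :=
  [/\ intdom Phi !=set0,
      (forall z, intdom Phi z -> differentiable (finPhi Phi) z) &
      (forall (u : nat -> 'rV[R]_n) (z : 'rV[R]_n),
          (forall k, intdom Phi (u k)) -> u @ \oo --> z -> bdry (edom Phi) z ->
          (fun k => enorm (gradPhi Phi (u k))) @ \oo --> +oo)].
Definition essentially_strictly_convex {R : realType} {n : nat}
    (Phi : 'rV[R]_n -> \bar R) : Prop :=
  forall C, convex_set C -> C `<=` dom_subdiff Phi -> strictly_convex_on Phi C.
Definition Legendre {R : realType} {n : nat} (Phi : 'rV[R]_n -> \bar R) : Prop :=
  [/\ Gamma0 Phi, essentially_smooth Phi & essentially_strictly_convex Phi].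

Definition C2_on {R : realType} {n : nat} (f : 'rV[R]_n -> R) (U : set 'rV[R]_n)
  : Prop :=
  [/\ (forall z, U z -> differentiable f z),
      (forall i z, U z -> differentiable (partial i f) z) &
      (forall i j z, U z -> {for z, continuous (partial j (partial i f))})].
Definition very_strictly_convex {R : realType} {n : nat} (Phi : 'rV[R]_n -> \bar R)
  : Prop :=
  forall z, intdom Phi z ->
    forall v : 'rV[R]_n, v != 0 -> 0 < dot (v *m hessian (finPhi Phi) z) v.

Definition conjugate {R : realType} {n : nat} (Phi : 'rV[R]_n -> \bar R)
  : 'rV[R]_n -> \bar R :=
  fun y => ereal_sup [set ((dot x y)%:E - Phi x)%E | x in [set: 'rV[R]_n]].

Definition Bregman {R : realType} {n : nat} (Phi : 'rV[R]_n -> \bar R)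
    (z1 z2 : 'rV[R]_n) : \bar R :=
  if `[< edom Phi z1 /\ intdom Phi z2 >] then
    (finPhi Phi z1 - finPhi Phi z2 - dot (gradPhi Phi z2) (z1 - z2))%:E
  else +oo%E.
Definition dist_Phi {R : realType} {n : nat} (Phi : 'rV[R]_n -> \bar R)
    (y : 'rV[R]_n) (Z : set 'rV[R]_n) : \bar R :=
  ereal_inf [set Bregman Phi x y | x in Z].
Definition edist {R : realType} {n : nat} (z : 'rV[R]_n) (Z : set 'rV[R]_n)
  : \bar R := ereal_inf [set (enorm (z - x))%:E | x in Z].

Definition monotone_op {R : realType} {n : nat} (T : 'rV[R]_n -> set 'rV[R]_n)
  : Prop :=
  forall z1 z2 w1 w2, T z1 w1 -> T z2 w2 -> 0 <= dot (w1 - w2) (z1 - z2).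
Definition maximal_monotone {R : realType} {n : nat}
    (T : 'rV[R]_n -> set 'rV[R]_n) : Prop :=
  monotone_op T /\
  forall T' : 'rV[R]_n -> set 'rV[R]_n, monotone_op T' ->
    (forall z w, T z w -> T' z w) -> forall z w, T' z w -> T z w.
Definition zer {R : realType} {n : nat} (T : 'rV[R]_n -> set 'rV[R]_n)
  : set 'rV[R]_n := [set z | T z 0].
Definition dom_op {R : realType} {n : nat} (T : 'rV[R]_n -> set 'rV[R]_n)
  : set 'rV[R]_n := [set z | T z !=set0].

Definition EB {R : realType} {n : nat} (T : 'rV[R]_n -> set 'rV[R]_n)
    (zbar : 'rV[R]_n) (delta kappa : R) : Prop :=
  forall z w, T z w -> enorm (z - zbar) <= delta -> enorm w <= delta ->
    (edist z (zer T) <= (kappa * enorm w)%:E)%E.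

Definition coercive {R : realType} {n : nat} (h : 'rV[R]_n -> \bar R) : Prop :=
  forall M : R, exists r : R, forall z, r < enorm z -> (M%:E < h z)%E.

Definition iBPPA {R : realType} {n : nat} (Phi : 'rV[R]_n -> \bar R)
    (T : 'rV[R]_n -> set 'rV[R]_n) (sigma rho : nat -> R)
    (z p w : nat -> 'rV[R]_n) : Prop :=
  intdom Phi (z 0%N) /\
  forall k,
    [/\ edom Phi (p k), T (p k) (w k),
        intdom (conjugate Phi) (gradPhi Phi (z k) - sigma k *: w k),
        z k.+1 = gradPhi (conjugate Phi) (gradPhi Phi (z k) - sigma k *: w k) &
        intdom Phi (z k.+1)] /\
    (Bregman Phi (p k) (z k.+1) <= (rho k)%:E * Bregman Phi (p k) (z k))%E.

Definition Ck {R : realType} (rhok sigmak kappa theta Theta : R) : R :=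
  (Num.sqrt rhok * Num.sqrt Theta / Num.sqrt theta
   + kappa / sigmak * Theta * (1 + Num.sqrt rhok)) ^+ 2 * (Theta / theta).
Definition qk {R : realType} (rhok sigmak kappa theta Theta : R) : R :=
  1 / (1 + (1 - rhok) / Ck rhok sigmak kappa theta Theta).

(* Main.v *)
(** Since [z k.+1] lies in [intdom Phi], essential strict convexity makes it the
    unique maximizer in the definition of the conjugate, whence
    [gradPhi Phi (z k.+1) = gradPhi Phi (z k) - sigma k *: w k].  Monotonicity of
    [T] against a zero [x] and the tolerance condition then give
    [D(x, z k.+1) + (1 - rho k) * D(p k, z k) <= D(x, z k)].
    As [z] converges, the gradient differences, hence [w k], tend to [0], and
    linear growth of [D(., z k.+1)] away from [z k.+1] forces [p k --> zinf].
    So everything eventually happens in a ball where [Phi] has Lipschitz gradient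
    and is strongly convex; there the error bound at [p k] yields
    [dist_Phi (z k.+1) <= C_k * D(p k, z k)], and the two estimates combine.
    Points of [zer T] that almost attain the distance to [p k] replace its
    projection onto [zer T].
    The upper estimate [D(a, b) <= Theta / 2 * |a - b|^2] comes for free from
    [D(a, b) <= <grad a - grad b, a - b>] by choosing [Theta] at least twice the
    Lipschitz constant of the gradient. *)
Require Import Defs.
From HB Require Import structures.
From mathcomp Require Import all_boot all_order all_algebra.
From mathcomp Require Import all_classical all_reals all_analysis.
From mathcomp Require Import ring lra.
Set Implicit Arguments. Unset Strict Implicit. Unset Printing Implicit Defensive.
Import Order.TTheory GRing.Theory Num.Theory.
Import numFieldNormedType.Exports.
Local Open Scope classical_set_scope.
Local Open Scope ring_scope.

(** * Euclidean structure and gradients *)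

Section Euclid.
Context {R : realType} {n : nat}.
Implicit Types (u v w : 'rV[R]_n) (c : R).

Lemma dotC u v : dot u v = dot v u.
Proof. by apply: eq_bigr => i _; rewrite mulrC. Qed.

Lemma dotDl u v w : dot (u + v) w = dot u w + dot v w.
Proof. by rewrite -big_split; apply: eq_bigr => i _; rewrite mxE mulrDl. Qed.

Lemma dotZl c u v : dot (c *: u) v = c * dot u v.
Proof. by rewrite mulr_sumr; apply: eq_bigr => i _; rewrite mxE mulrA. Qed.

Lemma dotNl u v : dot (- u) v = - dot u v.
Proof. by rewrite -scaleN1r dotZl mulN1r. Qed.

Lemma dotBl u v w : dot (u - v) w = dot u w - dot v w.
Proof. by rewrite dotDl dotNl. Qed.

Lemma dot0l v : dot 0 v = 0.
Proof. by rewrite /dot big1 // => i _; rewrite mxE mul0r. Qed.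

Lemma dotDr u v w : dot u (v + w) = dot u v + dot u w.
Proof. by rewrite dotC dotDl !(dotC u). Qed.

Lemma dotZr c u v : dot u (c *: v) = c * dot u v.
Proof. by rewrite dotC dotZl dotC. Qed.

Lemma dotNr u v : dot u (- v) = - dot u v.
Proof. by rewrite dotC dotNl dotC. Qed.

Lemma dotBr u v w : dot u (v - w) = dot u v - dot u w.
Proof. by rewrite dotDr dotNr. Qed.

Lemma dot_delta u i : dot u (delta_mx 0 i) = u 0 i.
Proof.
rewrite /dot (bigD1 i) //= mxE !eqxx mulr1 big1 ?addr0 // => j ji.
by rewrite mxE (negbTE ji) andbF mulr0.
Qed.

Lemma dot_ge0 u : 0 <= dot u u.
Proof. by apply: sumr_ge0 => i _; rewrite -expr2 sqr_ge0. Qed.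

Lemma enorm_ge0 u : 0 <= enorm u.
Proof. exact: sqrtr_ge0. Qed.

Lemma enorm_sqr u : enorm u ^+ 2 = dot u u.
Proof. by rewrite sqr_sqrtr ?dot_ge0. Qed.

Lemma enormN u : enorm (- u) = enorm u.
Proof. by rewrite /enorm dotNl dotNr opprK. Qed.

Lemma enormB u v : enorm (u - v) = enorm (v - u).
Proof. by rewrite -enormN opprB. Qed.

Lemma enormZ c u : enorm (c *: u) = `|c| * enorm u.
Proof.
by rewrite /enorm dotZl dotZr mulrA -expr2 sqrtrM ?sqr_ge0 // sqrtr_sqr.
Qed.

Lemma enorm0 : enorm (0 : 'rV[R]_n) = 0.
Proof. by rewrite -(scale0r 0) enormZ normr0 mul0r. Qed.

Lemma enorm_eq0 u : enorm u = 0 -> u = 0.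
Proof.
move=> u0; have : dot u u = 0 by rewrite -enorm_sqr u0 expr0n.
move/eqP; rewrite psumr_eq0 => [/allP H|i _]; last by rewrite -expr2 sqr_ge0.
apply/rowP => i; have := H i; rewrite mem_index_enum mulf_eq0 orbb => /(_ isT).
by move/eqP => ->; rewrite mxE.
Qed.

Lemma CauchySchwarz u v : `|dot u v| <= enorm u * enorm v.
Proof.
have [v0|v0] := eqVneq (enorm v) 0.
  move/enorm_eq0: (v0) => ->; rewrite enorm0 mulr0.
  by rewrite dotC dot0l normr0.
have vp : 0 < enorm v by rewrite lt_neqAle eq_sym v0 enorm_ge0.
rewrite -(@ler_pXn2r _ 2) ?nnegrE ?mulr_ge0 ?enorm_ge0 //.
rewrite real_normK ?num_real // exprMn.
have := dot_ge0 (dot v v *: u - dot u v *: v).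
rewrite dotBl !dotBr !dotZl !dotZr (dotC v u) -!enorm_sqr.
set a := enorm u ^+ 2; set d := dot u v; set b := enorm v ^+ 2.
have bp : 0 < b by rewrite exprn_gt0.
move=> H; have : 0 <= b * (a * b - d ^+ 2) by lra.
by rewrite pmulr_rge0 // subr_ge0.
Qed.

Lemma dot_le_enorm u v : dot u v <= enorm u * enorm v.
Proof. exact: le_trans (ler_norm _) (CauchySchwarz _ _). Qed.

Lemma enormD u v : enorm (u + v) <= enorm u + enorm v.
Proof.
rewrite -(@ler_pXn2r _ 2) ?nnegrE ?addr_ge0 ?enorm_ge0 //.
rewrite sqrrD !enorm_sqr dotDl !dotDr (dotC v u).
by have := dot_le_enorm u v; lra.
Qed.

Lemma enorm_triangle u v w : enorm (u - w) <= enorm (u - v) + enorm (v - w).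
Proof. by rewrite -[u - w](subrKA v); exact: enormD. Qed.

(** The built-in norm is the maximum norm, which carries the topology; the comparisons below tie it
    to [enorm] up to factors [n]. *)
Lemma coord_le_norm u i : `|u 0 i| <= `|u|.
Proof.
rewrite [leRHS]/Num.norm /= mx_normrE.
exact: (le_bigmax _ (fun ij => `|u ij.1 ij.2|) (ord0, i)).
Qed.

Lemma norm_leP u c : 0 <= c -> (forall i, `|u 0 i| <= c) -> `|u| <= c.
Proof.
move=> c0 H; rewrite [leLHS]/Num.norm /= mx_normrE.
by apply/bigmax_leP; split => // -[j i] _ /=; rewrite (ord1 j); exact: H.
Qed.

Lemma norm_le_enorm u : `|u| <= enorm u.
Proof.
apply: norm_leP (enorm_ge0 u) _ => i.
rewrite -(@ler_pXn2r _ 2) ?nnegrE ?enorm_ge0 // real_normK ?num_real // enorm_sqr.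
rewrite /dot (bigD1 i) //= -expr2 lerDl sumr_ge0 // => j _.
by rewrite -expr2 sqr_ge0.
Qed.

Lemma dot_le_norm u v : `|dot u v| <= n%:R * (`|u| * `|v|).
Proof.
apply: le_trans (ler_norm_sum _ _ _) _.
rewrite mulr_natl -[X in _ *+ X]card_ord -sumr_const; apply: ler_sum => i _.
by rewrite normrM ler_pM ?coord_le_norm.
Qed.

Lemma enorm_le_norm u : enorm u <= n%:R * `|u|.
Proof.
rewrite -(@ler_pXn2r _ 2) ?nnegrE ?mulr_ge0 ?enorm_ge0 // enorm_sqr.
apply: le_trans (ler_norm _) _; apply: le_trans (dot_le_norm _ _) _.
rewrite exprMn -expr2 ler_wpM2r ?sqr_ge0 //.
by rewrite -natrX ler_nat; case: (n) => // m; rewrite leq_pmulr.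
Qed.

Lemma derive_grad (f : 'rV[R]_n -> R) (a v : 'rV[R]_n) :
  differentiable f a -> 'D_v f a = dot (grad f a) v.
Proof.
move=> df; rewrite deriveE // [v in LHS]row_sum_delta linear_sum.
apply: eq_bigr => i _; rewrite linearZ /= mxE /partial deriveE //.
by rewrite mulrC.
Qed.

Lemma is_derive_line (f : 'rV[R]_n -> R) (b v : 'rV[R]_n) (t : R) :
  differentiable f (b + t *: v) ->
  is_derive t 1 (fun s : R => f (b + s *: v)) (dot (grad f (b + t *: v)) v).
Proof.
move=> df; rewrite -derive_grad //.
have E : (fun h : R =>
       h^-1 *: (((fun s : R => f (b + s *: v)) \o shift t) (h *: (1 : R)) - f (b + t *: v)))
   = (fun h : R => h^-1 *: ((f \o shift (b + t *: v)) (h *: v) - f (b + t *: v))).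
  apply/funext => h /=; rewrite [h *: 1]mulr1 scalerDl.
  by rewrite addrCA.
have dv : derivable f (b + t *: v) v by exact: diff_derivable.
split; first by rewrite /derivable E.
by rewrite /derive E.
Qed.
End Euclid.

(** * Gradient inequality and Bregman distances *)

Section RightDerivative.
Context {R : realType} {n : nat}.
Implicit Types (f : 'rV[R]_n -> R) (z v : 'rV[R]_n) (c : R).

(** Convexity controls difference quotients only for positive [t]; as the two-sided limit exists,
    its restriction to the right has the same value. *)
Lemma derive_le_right f z v c : derivable f z v ->
  (\forall t \near (0 : R)^'+, f (t *: v + z) - f z <= t * c) -> 'D_v f z <= c.
Proof.
move=> df H.
have C : (fun h : R => h^-1 *: ((f \o shift z) (h *: v) - f z)) @ (0 : R)^'+ --> 'D_v f z.
  apply: cvg_trans df; apply: cvg_app => A [e e0 eA]; exists e => // x xe x0.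
  exact: eA xe (lt0r_neq0 x0).
apply: (cvgr_to_le C).
near=> t; have t0 : 0 < t by near: t; exact: nbhs_right_gt.
rewrite /= [_ *: _]mulrC ler_pdivrMr // mulrC.
by near: t.
Unshelve. all: by end_near. Qed.

Lemma derive_ge_right f z v c : derivable f z v ->
  (\forall t \near (0 : R)^'+, t * c <= f (t *: v + z) - f z) -> c <= 'D_v f z.
Proof.
move=> df H; rewrite -[leRHS]opprK -deriveN // lerNr.
apply: derive_le_right; first exact: derivableN.
near=> t; rewrite /= !fctE mulrN -opprD lerN2.
by near: t.
Unshelve. all: by end_near. Qed.
End RightDerivative.

Section Convex.
Context {R : realType} {n : nat} (Phi : 'rV[R]_n -> \bar R).
Context (Pp : proper_fun Phi) (Pc : convex_fun Phi).
Implicit Types (x y z v : 'rV[R]_n).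
Local Notation f := (finPhi Phi).

Lemma intdom_edom z : intdom Phi z -> edom Phi z.
Proof. exact: nbhs_singleton. Qed.

Lemma edomE z : edom Phi z -> Phi z = (f z)%:E.
Proof.
have := Pp.1 z; rewrite /edom /finPhi /=; by case: (Phi z).
Qed.

Lemma fin_convex x y t : edom Phi x -> edom Phi y -> 0 < t <= 1 ->
  edom Phi (t *: x + (1 - t) *: y) /\
  f (t *: x + (1 - t) *: y) <= t * f x + (1 - t) * f y.
Proof.
move=> xd yd /andP[t0]; rewrite le_eqVlt => /predU1P[->|t1].
  by rewrite subrr scale0r addr0 scale1r mul0r addr0 mul1r.
have := @Pc x y t; rewrite t0 t1 => /(_ isT).
rewrite (edomE xd) (edomE yd) -!EFinM -EFinD => H.
have D : edom Phi (t *: x + (1 - t) *: y) by apply: le_lt_trans H _; rewrite ltry.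
by split => //; move: H; rewrite (edomE D) lee_fin.
Qed.

Lemma grad_ineq x z : edom Phi x -> edom Phi z -> differentiable f z ->
  f z + dot (grad f z) (x - z) <= f x.
Proof.
move=> xd zd df; rewrite -derive_grad // addrC -lerBrDr.
apply: derive_le_right; first exact: diff_derivable.
near=> t; have t0 : 0 < t by near: t; exact: nbhs_right_gt.
have t1 : t <= 1 by near: t; exact: nbhs_right_le.
have -> : t *: (x - z) + z = t *: x + (1 - t) *: z.
  by rewrite scalerBr scalerBl scale1r -addrA [- _ + z]addrC.
have [_] := @fin_convex x z t xd zd (introT andP (conj t0 t1)).
by rewrite mulrBr; lra.
Unshelve. all: by end_near. Qed.

(** First-order optimality in the single direction [- u], with [u] the gradient minus [y], already
    forces [dot u u <= 0]; interiority keeps [z - t u] in the domain for small [t]. *)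
Lemma grad_unique z y : edom Phi z -> differentiable f z -> intdom Phi z ->
  (forall x, edom Phi x -> f z - dot z y <= f x - dot x y) -> grad f z = y.
Proof.
move=> zd df zi H; apply/eqP; rewrite -subr_eq0; apply/eqP.
set u := _ - y; suff : dot u (- u) >= 0.
  rewrite dotNr oppr_ge0 -enorm_sqr => u0; apply: enorm_eq0; apply/eqP.
  by rewrite -sqrf_eq0 eq_le u0 sqr_ge0.
rewrite {1}/u dotBl subr_ge0 -derive_grad //.
apply: derive_ge_right; first exact: diff_derivable.
have : (\forall t \near (0 : R)^'+, edom Phi (t *: (- u) + z)).
  have C : (fun t : R => t *: (- u) + z) @ (0 : R)^'+ --> z.
    apply: cvg_at_right_filter.
    rewrite -[X in _ --> X]add0r -[X in X + z](scale0r (- u)).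
    by apply: cvgD; [apply: cvgZr_tmp; exact: cvg_id | exact: cvg_cst].
  exact: (C _ zi).
apply: filterS => t td; have := H _ td.
by rewrite dotDl dotZl (dotC (- u)); lra.
Qed.

Definition brD x y := f x - f y - dot (gradPhi Phi y) (x - y).

Lemma BregmanE x y : edom Phi x -> intdom Phi y -> Bregman Phi x y = (brD x y)%:E.
Proof. by move=> xd yi; rewrite /Bregman asboolT. Qed.

Lemma brD_three_point x y z :
  brD x z = brD x y + brD y z + dot (gradPhi Phi y - gradPhi Phi z) (x - y).
Proof.
rewrite /brD dotBl -[x - z](subrKA y) [dot (gradPhi Phi z) (x - y + _)]dotDr.
by ring.
Qed.

Lemma brD_ge0 x z : edom Phi x -> edom Phi z -> differentiable f z -> 0 <= brD x z.
Proof. by move=> xd zd df; have := grad_ineq xd zd df; rewrite /brD /gradPhi; lra. Qed.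

(** The right-hand side is [brD x z + brD z x], and the second summand is nonnegative by the
    gradient inequality at [x]. *)
Lemma brD_le_dot x z : edom Phi x -> edom Phi z -> differentiable f x ->
  brD x z <= dot (gradPhi Phi x - gradPhi Phi z) (x - z).
Proof.
move=> xd zd df; have := grad_ineq zd xd df.
by rewrite /brD /gradPhi dotBl -[z - x]opprB dotNr; lra.
Qed.

(** [brD] is convex in its first argument and vanishes on the diagonal, so the bound at the point
    [q] of the segment at distance [r] from [z] propagates linearly outward. *)
Lemma brD_growth p z (r c : R) : 0 < r -> edom Phi p -> edom Phi z ->
  (forall q, edom Phi q -> enorm (q - z) <= r -> c * enorm (q - z) ^+ 2 <= brD q z) ->
  r <= enorm (p - z) -> c * r * enorm (p - z) <= brD p z.
Proof.
move=> r0 pd zd H rp; set d := enorm (p - z).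
have d0 : 0 < d by exact: lt_le_trans rp.
have t01 : 0 < r / d <= 1 by rewrite divr_gt0 //= ler_pdivrMr // mul1r.
have [qd qf] := fin_convex pd zd t01.
set q := _ + _ in qd qf.
have qz : q - z = (r / d) *: (p - z).
  by rewrite /q scalerBl scale1r scalerBr addrA addrAC addrK.
have eq : enorm (q - z) = r.
  by rewrite qz enormZ gtr0_norm ?divr_gt0 // divfK // gt_eqF.
have := H q qd; rewrite eq lexx => /(_ isT) H1.
have : c * r ^+ 2 <= r / d * brD p z.
  by apply: le_trans H1 _; rewrite /brD qz dotZr; move: qf; lra.
by rewrite expr2 mulrA [leRHS]mulrAC -[leRHS]mulrA mulrC ler_pM2l // ler_pdivlMr.
Qed.
End Convex.

(** * Minimizers of Phi minus a linear form *)

(** The sublevel sets of [F] in [K] generate a proper filter. A cluster point is a minimizer, for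
    lower semicontinuity would otherwise separate it from one of them. *)
Lemma lsc_compact_min {R : realType} {X : topologicalType} (F : X -> \bar R)
    (K : set X) : lower_semicontinuous F -> compact K -> K !=set0 ->
  exists2 x0, K x0 & forall x, K x -> (F x0 <= F x)%E.
Proof.
move=> Fl Kc [k0 Kk0].
pose G : set_system X :=
  [set A | exists2 x, K x & [set y | K y /\ (F y <= F x)%E] `<=` A].
have PG : ProperFilter G.
  split; first by move=> [x Kx] /(_ x); apply; split.
  split.
  - by exists k0.
  - move=> A B [x Kx xA] [y Ky yB]; have [xy|yx] := leP (F x) (F y).
      exists x => // w [Kw wx]; split; first exact: xA.
      by apply: yB; split => //; exact: le_trans xy.
    exists y => // w [Kw wy]; split; last exact: yB.
    by apply: xA; split => //; exact: le_trans (ltW yx).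
  - by move=> A B AB [x Kx xA]; exists x => //; exact: subset_trans AB.
have GK : G K by exists k0 => // w [].
have [x0 [Kx0 clx0]] := Kc G PG GK.
exists x0 => // x Kx; rewrite leNgt; apply/negP => lt.
have [a xa ax0] : exists2 a : R, (F x <= a%:E)%E & (a%:E < F x0)%E.
  case: (F x) lt => [a| |]; first by exists a.
    by rewrite ltNge leey.
  by case: (F x0) => [b| |] // _; [exists (b - 1); rewrite ?leNye // lte_fin; lra
    |exists 0; rewrite ?leNye ?ltry].
have [V Vx0 VF] := Fl x0 a ax0.
have [w [[Kw wx] Vw]] : [set y | K y /\ (F y <= F x)%E] `&` V !=set0.
  by apply: clx0 => //; exists x.
by have := lt_le_trans (VF w Vw) (le_trans wx xa); rewrite ltxx.
Qed.

Section Tilt.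
Context {R : realType} {n : nat} (Phi : 'rV[R]_n -> \bar R) (y : 'rV[R]_n).
Context (Pp : proper_fun Phi) (Pc : convex_fun Phi) (Pl : lower_semicontinuous Phi).
Local Notation f := (finPhi Phi).
Local Notation g := (fun x => f x - dot x y).

Lemma dot_cvg (x0 : 'rV[R]_n) (e : R) : 0 < e ->
  \forall x \near x0, dot x y < dot x0 y + e.
Proof.
move=> e0; have d0 : 0 < e / (n%:R * `|y| + 1).
  by rewrite divr_gt0 // ltr_wpDl // mulr_ge0.
near=> x; rewrite -ltrBlDl -dotBl; apply: le_lt_trans (ler_norm _) _.
apply: le_lt_trans (dot_le_norm _ _) _.
have H : `|x0 - x| < e / (n%:R * `|y| + 1).
  by near: x; apply: cvgr_dist_lt => //; exact: cvg_id.
rewrite mulrCA distrC.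
move: H; rewrite ltr_pdivlMr ?ltr_wpDl ?mulr_ge0 // => H.
apply: le_lt_trans H; rewrite ler_wpM2l // lerDl //.
Unshelve. all: by end_near. Qed.

Lemma lsc_tilt : lower_semicontinuous (fun x => Phi x - (dot x y)%:E)%E.
Proof.
move=> x0 a H.
have [e e0 He] : exists2 e : R, 0 < e & ((a + (dot x0 y + e))%:E < Phi x0)%E.
  move: H; case E : (Phi x0) => [b| |] //.
    rewrite -EFinB lte_fin => H; exists ((b - a - dot x0 y) / 2); first lra.
    by rewrite lte_fin; lra.
  by exists 1 => //; rewrite ltry.
have [V Vx0 VP] := Pl He.
exists (V `&` [set x | dot x y < dot x0 y + e]).
  by apply: filterI => //; exact: dot_cvg.
move=> x [/VP VPx /= dx]; have : ((a + dot x y)%:E < Phi x)%E.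
  by apply: lt_trans VPx; rewrite lte_fin ltrD2l.
case: (Phi x) => [b| _|]; [|by rewrite ltry|by rewrite ltNge leNye].
by rewrite -EFinB !lte_fin; lra.
Qed.

Lemma tilt_compact_min (K : set 'rV[R]_n) : compact K -> edom Phi `&` K !=set0 ->
  exists2 x0, edom Phi x0 /\ K x0 & forall x, edom Phi x -> K x -> g x0 <= g x.
Proof.
move=> Kc [k [kd Kk]].
have [x0 Kx0 H] := lsc_compact_min lsc_tilt Kc (ex_intro _ k Kk).
have x0d : (Phi x0 < +oo)%E.
  have := H k Kk; rewrite (edomE Pp kd) -EFinB.
  by case: (Phi x0) => [r _| |_] //; rewrite ltry.
exists x0 => // x xd Kx; have := H x Kx.
by rewrite (edomE Pp x0d) (edomE Pp xd) -!EFinB lee_fin.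
Qed.

Lemma closed_ball_compact (r : R) : compact [set x : 'rV[R]_n | `|x| <= r].
Proof.
apply: bounded_closed_compact.
  by exists r; split; [exact: num_real|move=> M rM x /= /le_trans; apply; exact: ltW].
have -> : [set x : 'rV[R]_n | `|x| <= r] = Num.norm @^-1` [set t : R | t <= r] by [].
by apply: closed_comp (@closed_le _ _) => x _; exact: norm_continuous.
Qed.

Lemma sphere_compact (x0 : 'rV[R]_n) (r : R) : compact [set x : 'rV[R]_n | `|x - x0| = r].
Proof.
apply: bounded_closed_compact.
  exists (r + `|x0|); split; first exact: num_real.
  move=> M rM x /= xr; rewrite -[x](subrK x0).
  by apply: le_trans (ler_normD _ _) _; rewrite xr ltW.
have -> : [set x : 'rV[R]_n | `|x - x0| = r] =
    (fun x => `|x - x0|) @^-1` [set r] by [].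
apply: closed_comp (@closed_eq _ _) => x _.
apply: (@continuous_comp _ _ _ (fun u : 'rV[R]_n => u - x0) (@Num.norm _ 'rV[R]_n)).
  by apply: differentiable_continuous.
exact: norm_continuous.
Qed.

(** Equivalently, [y] is a subgradient of [Phi] at [x0], or [x0] attains the supremum defining
    [conjugate Phi y]. *)
Definition minimizer (x0 : 'rV[R]_n) :=
  edom Phi x0 /\ forall x, edom Phi x -> g x0 <= g x.

Lemma coercive_minimizer (r M : R) : 0 < r ->
  (forall x, edom Phi x -> r * `|x| - M <= g x) -> exists x0, minimizer x0.
Proof.
move=> r0 H; have [x1 x1d] := Pp.2.
(* The ball contains [x1], and outside it the linear lower bound exceeds [g x1]. *)
pose s := Num.max `|x1| ((g x1 + M) / r).
have [|x0 [x0d Kx0] x0m] := tilt_compact_min (@closed_ball_compact s).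
  by exists x1; split => //=; rewrite le_max lexx.
exists x0; split => // x xd.
have [xs|xs] := leP `|x| s; first exact: x0m.
apply: (@le_trans _ _ (g x1)); first by apply: x0m => //=; rewrite le_max lexx.
apply: le_trans (H x xd).
by move: xs; rewrite gt_max => /andP[_]; rewrite ltr_pdivrMr // mulrC; lra.
Qed.

Lemma tilt_convex x x' t : edom Phi x -> edom Phi x' -> 0 < t <= 1 ->
  g (t *: x + (1 - t) *: x') <= t * g x + (1 - t) * g x'.
Proof.
move=> xd xd' t01; have [_] := fin_convex Pp Pc xd xd' t01.
by rewrite dotDl !dotZl; lra.
Qed.

(** Minimizers form a convex set on which [y] is a subgradient, so essential strict convexity
    applies there; the midpoint of two distinct ones would have a smaller value. *)
Lemma minimizer_unique x0 x1 : essentially_strictly_convex Phi ->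
  minimizer x0 -> minimizer x1 -> x0 = x1.
Proof.
move=> Ps m0 m1; apply: contrapT => ne.
have C : Defs.convex_set minimizer.
  move=> a b t ma mb /andP[]; rewrite le_eqVlt => /predU1P[<- _|t0 t1].
    by rewrite scale0r add0r subr0 scale1r.
  have t01 : 0 < t <= 1 by rewrite t0.
  have [d _] := fin_convex Pp Pc ma.1 mb.1 t01.
  split => // x xd; apply: le_trans (tilt_convex ma.1 mb.1 t01) _.
  have E : g a = g b by apply/le_anti; rewrite (ma.2 b mb.1) (mb.2 a ma.1).
  by have := mb.2 x xd; move: E => /= ->; lra.
have S : minimizer `<=` dom_subdiff Phi.
  move=> a [ad am]; exists y; split; first by rewrite (edomE Pp ad).
  move=> x; case: (ltP (Phi x) +oo%E) => [xd|]; last first.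
    by rewrite leye_eq => /eqP ->; rewrite leey.
  rewrite (edomE Pp ad) (edomE Pp xd) -EFinD lee_fin dotC dotBl.
  by have := am x xd; lra.
have h01 : 0 < (2^-1 : R) < 1 by apply/andP; split; lra.
have h01' : 0 < (2^-1 : R) <= 1 by apply/andP; split; lra.
have := Ps _ C S x0 x1 _ m0 m1 ne h01.
have [d _] := fin_convex Pp Pc m0.1 m1.1 h01'.
rewrite (edomE Pp d) (edomE Pp m0.1) (edomE Pp m1.1) -!EFinM -EFinD lte_fin.
have := m0.2 _ d; have := m1.2 _ d; rewrite /= !dotDl !dotZl; lra.
Qed.

(** Uniqueness puts the minimum of [g] over the sphere of radius [e] strictly above [g x0];
    convexity along rays from [x0] turns this gap into linear growth. *)
Lemma minimizer_growth x0 (e : R) : essentially_strictly_convex Phi ->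
  minimizer x0 -> 0 < e -> exists2 eta : R, 0 < eta &
  forall x, edom Phi x -> e <= `|x - x0| -> g x0 + eta * `|x - x0| <= g x.
Proof.
move=> Ps m0 e0.
have onsphere x : edom Phi x -> e <= `|x - x0| ->
    exists2 q, edom Phi q /\ `|q - x0| = e &
      g q <= e / `|x - x0| * g x + (1 - e / `|x - x0|) * g x0.
  move=> xd ex; have d0 : 0 < `|x - x0| by exact: lt_le_trans ex.
  have t01 : 0 < e / `|x - x0| <= 1 by rewrite divr_gt0 //= ler_pdivrMr // mul1r.
  have [d _] := fin_convex Pp Pc xd m0.1 t01.
  exists (e / `|x - x0| *: x + (1 - e / `|x - x0|) *: x0); last exact: tilt_convex xd m0.1 t01.
  split => //; rewrite scalerBl scale1r addrA addrAC addrK -scalerBr normrZ.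
  by rewrite gtr0_norm ?divr_gt0 // divfK // gt_eqF.
(* If the sphere misses the domain, convexity forbids domain points beyond it and the claim is
   vacuous. *)
have [[k kS]|noS] := pselect (edom Phi `&` [set x | `|x - x0| = e] !=set0); last first.
  exists 1 => // x xd ex; have [q [qd qe] _] := onsphere x xd ex.
  by exfalso; apply: noS; exists q.
have [x1 [x1d x1e] x1m] := tilt_compact_min (@sphere_compact x0 e) (ex_intro _ k kS).
have gt : g x0 < g x1.
  rewrite lt_neqAle m0.2 // andbT; apply/eqP => E.
  have m1 : minimizer x1 by split => // x xd; rewrite -E; exact: m0.2.
  have := minimizer_unique Ps m0 m1 => E1; move: x1e; rewrite /= -E1 subrr normr0 => E2.
  by move: e0; rewrite -E2 ltxx.
exists ((g x1 - g x0) / e); first by rewrite divr_gt0 // subr_gt0.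
move=> x xd ex; have [q [qd qe] qg] := onsphere x xd ex.
have d0 : 0 < `|x - x0| by exact: lt_le_trans ex.
have : g x1 - g x0 <= e / `|x - x0| * (g x - g x0).
  by have := x1m q qd qe; move: qg; rewrite /=; lra.
rewrite mulrAC ler_pdivlMr // => H.
by rewrite -lerBrDl mulrAC ler_pdivrMr // [leRHS]mulrC.
Qed.
End Tilt.

(** * Gradient of the conjugate *)

Section Conjugate.
Context {R : realType} {n : nat} (Phi : 'rV[R]_n -> \bar R) (y : 'rV[R]_n).
Context (Pp : proper_fun Phi) (Pc : convex_fun Phi) (Pl : lower_semicontinuous Phi).
Context (Ps : essentially_strictly_convex Phi).
Local Notation f := (finPhi Phi).

Lemma conjugate_ge x y' : ((dot x y')%:E - Phi x <= conjugate Phi y')%E.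
Proof. by apply: ereal_sup_ubound; exists x. Qed.

Lemma fenchel_young x y' : edom Phi x -> edom (conjugate Phi) y' ->
  dot x y' - f x <= fine (conjugate Phi y').
Proof.
move=> xd; rewrite /edom /=; have := conjugate_ge x y'.
rewrite (edomE Pp xd) -EFinB; case: (conjugate Phi y') => [r| |] //.
Qed.

(** Fenchel's inequality at [y + r e_i] and [y - r e_i], where the conjugate is finite, bounds [r]
    times each coordinate of [x], hence its maximum norm. *)
Lemma conjugate_growth : intdom (conjugate Phi) y -> exists2 rM : R * R, 0 < rM.1 &
  forall x, edom Phi x -> rM.1 * `|x| - rM.2 <= f x - dot x y.
Proof.
move=> yi; have /nbhs_ballP [e /= e0 eB] := yi.
have [r r0 re] : exists2 r : R, 0 < r & r < e by exists (e / 2); lra.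
have dom c i : `|c| = r -> edom (conjugate Phi) (y + c *: delta_mx 0 i).
  move=> cr; apply: eB; rewrite -ball_normE /ball_ /= opprD addNKr normrN.
  apply: le_lt_trans re.
  apply: norm_leP => [|j]; first exact: ltW.
  rewrite !mxE normrM cr; case: (_ && _); rewrite ?normr1 ?normr0 ?mulr1 //.
  by rewrite mulr0 ltW.
have yd : edom (conjugate Phi) y by exact: nbhs_singleton yi.
pose S (c : R) : R := \sum_i `|fine (conjugate Phi (y + c *: delta_mx 0 i))|.
exists (r, `|fine (conjugate Phi y)| + (S r + S (- r))) => //= x xd.
have S0 c : 0 <= S c by exact: sumr_ge0.
have Si c i : `|fine (conjugate Phi (y + c *: delta_mx 0 i))| <= S c.
  by rewrite /S (bigD1 i) //= lerDl sumr_ge0.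
have A0 := fenchel_young xd yd.
have N0 := ler_norm (fine (conjugate Phi y)).
have S1 := S0 r; have S2 := S0 (- r).
have A3 : 0 <= `|fine (conjugate Phi y)| by exact: normr_ge0.
move: A3 N0; set A : R := `|fine _| => A3 N0; set m : R := A + _.
have c0 : 0 <= f x - dot x y + m by rewrite /m; lra.
suff : `|x| <= (f x - dot x y + m) / r by rewrite ler_pdivlMr //=; lra.
apply: norm_leP => [|i]; first by rewrite divr_ge0 // ltW.
rewrite ler_pdivlMr //.
have A1 := fenchel_young xd (dom r i (gtr0_norm r0)).
have A2 := fenchel_young xd (dom (- r) i (etrans (normrN _) (gtr0_norm r0))).
have N1 := le_trans (ler_norm _) (Si r i); have N2 := le_trans (ler_norm _) (Si (- r) i).
move: A1 A2; rewrite !dotDr !dotZr !dot_delta /m => A1 A2.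
have [xi|xi] := lerP 0 (x 0 i); rewrite ?(ger0_norm xi) ?(ltr0_norm xi); lra.
Qed.

(** Testing the supremum at [x0] bounds the increment of the conjugate from below. From above,
    points at distance at least [e] from [x0] are penalized by [minimizer_growth] more than they
    gain once the modulus of [h] is at most [eta]; nearer points contribute an error of at most [e]
    times that modulus. *)
Lemma grad_conjugate_minimizer x0 : minimizer Phi y x0 -> gradPhi (conjugate Phi) y = x0.
Proof.
move=> m0; apply/rowP => i; rewrite /gradPhi mxE /partial.
have conj_y : conjugate Phi y = (dot x0 y - f x0)%:E.
  apply/le_anti/andP; split; last first.
    by apply: le_trans (conjugate_ge x0 y); rewrite (edomE Pp m0.1).
  apply: ge_ereal_sup => _ [x _ <-].
  case: (ltP (Phi x) +oo%E) => [xd|]; last first.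
    by rewrite leye_eq => /eqP ->; rewrite leNye.
  by rewrite (edomE Pp xd) -EFinB lee_fin; have := m0.2 _ xd; lra.
have key (e : R) : 0 < e -> \forall h \near (0 : R),
    `|finPhi (conjugate Phi) (h *: delta_mx 0 i + y) - finPhi (conjugate Phi) y
      - h * x0 0 i| <= `|h| * e.
  move=> e0; have [eta eta0 H] := minimizer_growth Pp Pc Pl Ps m0 e0.
  near=> h; have heta : `|h| <= eta.
    by near: h; apply: (@nbhs0_le _ R).
  set y' := _ + y.
  have dy' x : dot x y' = dot x y + h * x 0 i.
    by rewrite /y' dotDr dotZr dot_delta addrC.
  have lo : ((dot x0 y - f x0 + h * x0 0 i)%:E <= conjugate Phi y')%E.
    apply: le_trans (conjugate_ge x0 y'); rewrite (edomE Pp m0.1) -EFinB lee_fin.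
    by rewrite dy'; lra.
  have hi : (conjugate Phi y' <= (dot x0 y - f x0 + h * x0 0 i + `|h| * e)%:E)%E.
    apply: ge_ereal_sup => _ [x _ <-].
    case: (ltP (Phi x) +oo%E) => [xd|]; last first.
      by rewrite leye_eq => /eqP ->; rewrite leNye.
    rewrite (edomE Pp xd) -EFinB lee_fin dy'.
    have hx : h * x 0 i - h * x0 0 i <= `|h| * `|x - x0|.
      rewrite -mulrBr; apply: le_trans (ler_norm _) _; rewrite normrM ler_wpM2l //.
      by have := coord_le_norm (x - x0) i; rewrite !mxE.
    have [ex|ex] := lerP e `|x - x0|.
      have := H x xd ex; rewrite /= => H1.
      have : `|h| * `|x - x0| <= eta * `|x - x0| by rewrite ler_wpM2r.
      have : 0 <= `|h| * e by rewrite mulr_ge0 // ltW.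
      lra.
    have : `|h| * `|x - x0| <= `|h| * e by rewrite ler_wpM2l // ltW.
    have := m0.2 _ xd; rewrite /=; lra.
  rewrite {1 2}/finPhi conj_y /=.
  move: lo hi; case: (conjugate Phi y') => [c| |] //; rewrite !lee_fin => lo hi.
  by rewrite /= ler_norml; apply/andP; split; lra.
apply: cvg_lim => //; apply/cvgrPdist_le => e e0.
have [d /= d0 dB] := (nbhs_ballP _ _).1 (key e e0).
exists d => // h hd h0 /=.
have := dB h hd; rewrite /=.
set F := _ - finPhi _ y.
rewrite -[h^-1 *: F]/(h^-1 * F) => H.
have hp : 0 < `|h| by rewrite normr_gt0.
rewrite -(ler_pM2l hp) -normrM mulrBr mulrA divff // mul1r distrC.
exact: H.
Unshelve. all: by end_near. Qed.

(** Growth yields a minimizer, which is the gradient of the conjugate; first-order optimality at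
    this interior point returns [y]. *)
Lemma gradK_conjugate : (forall x, intdom Phi x -> differentiable f x) ->
  intdom (conjugate Phi) y -> intdom Phi (gradPhi (conjugate Phi) y) ->
  gradPhi Phi (gradPhi (conjugate Phi) y) = y.
Proof.
move=> df yi; have [[r M] /= r0 H] := conjugate_growth yi.
have [x0 m0] := coercive_minimizer Pp Pl r0 H.
rewrite (grad_conjugate_minimizer m0) => xi.
by apply: grad_unique (m0.2) => //; [exact: m0.1 | exact: df].
Qed.
End Conjugate.

(** * Local bounds from a positive definite Hessian *)

Section LocalC2.
Context {R : realType} {n : nat}.
Implicit Types (f : 'rV[R]_n -> R) (a b c v z : 'rV[R]_n).

Lemma mvt_line f a b :
  (forall t, 0 <= t <= 1 -> differentiable f (b + t *: (a - b))) ->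
  exists2 t, 0 < t < 1 & f a - f b = dot (grad f (b + t *: (a - b))) (a - b).
Proof.
move=> df; pose g (s : R) := f (b + s *: (a - b)).
have dg (t : R) : 0 <= t <= 1 -> is_derive t 1 g (dot (grad f (b + t *: (a - b))) (a - b)).
  by move=> t01; apply: is_derive_line; exact: df.
have [|||t] := @MVT R g (fun t => dot (grad f (b + t *: (a - b))) (a - b)) 0 1.
- exact: ltr01.
- by move=> t; rewrite in_itv /= => /andP[t0 t1]; apply: dg; rewrite !ltW.
- apply: derivable_within_continuous => t; rewrite in_itv /= => t01.
  by have := dg t t01; case.
rewrite in_itv /= => t01; rewrite /g scale1r scale0r addr0 subr0 mulr1 [b + _]addrC subrK.
by exists t.
Qed.

Lemma quad_sum (H : 'M[R]_n) v : dot (v *m H) v = \sum_i v 0 i * (\sum_j H i j * v 0 j).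
Proof.
under [RHS]eq_bigr do rewrite mulr_sumr.
rewrite exchange_big; apply: eq_bigr => j _ /=; rewrite mxE mulr_suml.
by apply: eq_bigr => i _; rewrite mulrA.
Qed.

Lemma quad_continuous (H : 'M[R]_n) : continuous (fun v => dot (v *m H) v).
Proof.
have -> : (fun v => dot (v *m H) v) =
    \sum_i \sum_j (fun v : 'rV[R]_n => v 0 i * (H i j * v 0 j)).
  apply/funext => v; rewrite quad_sum fct_sumE; apply: eq_bigr => i _.
  by rewrite fct_sumE mulr_sumr.
move=> v; apply: differentiable_continuous.
apply: differentiable_sum => i; apply: differentiable_sum => j.
apply: differentiableM; first exact: differentiable_coord.
apply: differentiableM; first exact: differentiable_cst.
exact: differentiable_coord.
Qed.

(** The form has a positive minimum on the unit sphere, and homogeneity does the rest. The sphere is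
    empty only for [n = 0]. *)
Lemma quad_coercive (H : 'M[R]_n) : (forall v, v != 0 -> 0 < dot (v *m H) v) ->
  exists2 th : R, 0 < th & forall v, th * `|v| ^+ 2 <= dot (v *m H) v.
Proof.
move=> Hpos.
have [S0|S0] := pselect ([set u : 'rV[R]_n | `|u - 0| = 1] !=set0); last first.
  exists 1 => // v; suff -> : v = 0.
    by rewrite normr0 expr0n mulr0 mul0mx dot0l.
  apply: contrapT => /eqP v0; apply: S0; exists (`|v|^-1 *: v) => /=.
  by rewrite subr0 normrZ normfV normr_id mulVf // normr_eq0.
have [c cS cm] := EVT_min_rV S0 (@sphere_compact R n 0 1)
  (continuous_subspaceT (@quad_continuous H)).
move: cS; rewrite inE /= subr0 => c1.
have c0 : c != 0 by rewrite -normr_eq0 c1 oner_neq0.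
exists (dot (c *m H) c) => [|v]; first exact: Hpos.
have [->|v0] := eqVneq v 0.
  by rewrite normr0 expr0n mulr0 mul0mx dot0l.
have vp : 0 < `|v| by rewrite normr_gt0.
have : dot (c *m H) c <= dot ((`|v|^-1 *: v) *m H) (`|v|^-1 *: v).
  by apply: cm; rewrite inE /= subr0 normrZ normfV normr_id mulVf // normr_eq0.
rewrite -scalemxAl dotZl dotZr mulrA -expr2 => H1.
by rewrite -ler_pdivlMr ?exprn_gt0 // mulrC -exprVn.
Qed.

Lemma quad_perturb (H D : 'M[R]_n) (e : R) v : (forall i j, `|D i j - H i j| <= e) ->
  dot (v *m H) v - n%:R ^+ 2 * e * `|v| ^+ 2 <= dot (v *m D) v.
Proof.
move=> HD; rewrite lerBlDr -lerBlDl -dotBl -mulmxBr.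
(* Nonnegativity of [e] is read off a matrix entry, which exists only for [n > 0]. *)
have [n0|n0] := posnP n.
  suff -> : v = 0 by rewrite mul0mx dot0l normr0 expr0n mulr0.
  by apply/rowP => i; move: (ltn_ord i); rewrite {2}n0.
have e0 : 0 <= e by have := HD (Ordinal n0) (Ordinal n0); exact: le_trans.
apply: le_trans (ler_norm _) _; apply: le_trans (dot_le_norm _ _) _.
rewrite !expr2 -!mulrA ler_wpM2l // !mulrA ler_wpM2r //.
apply: norm_leP => [|j]; first by rewrite !mulr_ge0.
rewrite mxE; apply: le_trans (ler_norm_sum _ _ _) _.
rewrite -mulrA mulr_natl -[X in _ *+ X]card_ord -sumr_const; apply: ler_sum => i _.
by rewrite normrM mulrC !mxE distrC ler_pM ?coord_le_norm.
Qed.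

Lemma near_coords (F : 'I_n -> 'I_n -> 'rV[R]_n -> R) (z0 : 'rV[R]_n) (e : R) : 0 < e ->
  (forall i j, {for z0, continuous (F i j)}) ->
  \forall x \near z0, forall i j, `|F i j x - F i j z0| <= e.
Proof.
move=> e0 cF.
have H i j : nbhs z0 [set x | `|F i j x - F i j z0| <= e].
  have /cvgrPdist_le /(_ e e0) := cF i j.
  by apply: filterS => x; rewrite distrC.
have Fz : Filter (nbhs z0) := nbhs_filter z0.
exact: (@filter_forall _ _ (fun i x => forall j, `|F i j x - F i j z0| <= e) _ Fz
  (fun i => @filter_forall _ _ _ _ Fz (H i))).
Qed.

Lemma quad_grad f v c : (forall i, differentiable (partial i f) c) ->
  let phi := fun x => dot v (grad f x) in
  differentiable phi c /\ dot (grad phi c) v = dot (v *m hessian f c) v.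
Proof.
move=> df phi.
have E : phi = \sum_i (v 0 i \*: partial i f).
  by apply/funext => x; rewrite fct_sumE; apply: eq_bigr => i _; rewrite mxE.
have dphi : differentiable phi c.
  by rewrite E; apply: differentiable_sum => i; exact: differentiableZ.
split => //; rewrite -derive_grad // quad_sum E derive_sum; last first.
  by move=> i; apply: derivableZ; exact: diff_derivable.
apply: eq_bigr => i _; rewrite deriveZ; last exact: diff_derivable.
rewrite derive_grad //; congr (_ * _); apply: eq_bigr => j _; by rewrite !mxE.
Qed.

Lemma segment_ball a b (z0 : 'rV[R]_n) (r t : R) : 0 <= t <= 1 -> `|a - z0| < r -> `|b - z0| < r ->
  `|b + t *: (a - b) - z0| < r.
Proof.
move=> /andP[t0 t1] ar br.
have -> : b + t *: (a - b) - z0 = t *: (a - z0) + (1 - t) *: (b - z0).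
  apply/rowP => i; rewrite !mxE; ring.
apply: le_lt_trans (ler_normD _ _) _; rewrite !normrZ (ger0_norm t0) ger0_norm ?subr_ge0 //.
have [->|tn] := eqVneq t 0; first by rewrite mul0r add0r subr0 mul1r.
have tp : 0 < t by rewrite lt_neqAle eq_sym tn.
have : t * `|a - z0| < t * r by rewrite ltr_pM2l.
have : (1 - t) * `|b - z0| <= (1 - t) * r by rewrite ler_wpM2l ?subr_ge0 // ltW.
lra.
Qed.

Lemma is_derive_quadratic (p q t : R) :
  is_derive t 1 (fun s : R => s * p + q / 2 * s ^+ 2) (p + t * q).
Proof.
have d1 := is_deriveM (is_derive_id t (1 : R)) (is_derive_cst p t (1 : R)).
have d2 := is_deriveM (is_derive_id t (1 : R)) (is_derive_id t (1 : R)).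
have -> : p + t * q = (t *: (0 : R) + p *: (1 : R)) + (q / 2) *: (t *: (1 : R) + t *: (1 : R)).
  by rewrite /GRing.scale /=; field.
exact: (is_deriveD d1 (is_deriveZ (q / 2) d2)).
Qed.

(** Near [z0] the Hessian keeps half of its coercivity and has bounded entries. The mean value
    theorem applied to each partial gives the Lipschitz bound; applied to the directional derivative
    and then to [f] minus a quadratic, it gives strong convexity. *)
Lemma C2_local_bounds f (U : set 'rV[R]_n) (z0 : 'rV[R]_n) : nbhs z0 U -> C2_on f U ->
  (forall v, v != 0 -> 0 < dot (v *m hessian f z0) v) ->
  exists r th L : R, [/\ 0 < r, 0 < th, 0 <= L,
    eball z0 r `<=` U &
    forall a b, eball z0 r a -> eball z0 r b ->
      enorm (grad f a - grad f b) <= L * enorm (a - b) /\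
      th / 2 * enorm (a - b) ^+ 2 <= f a - f b - dot (grad f b) (a - b)].
Proof.
move=> Uz0 [df ddf cddf] Hpos.
have [th th0 thH] := quad_coercive Hpos.
(* The square of [n] is both the factor between squared norms and the loss factor in [quad_perturb];
   adding 1 keeps [N] positive for [n = 0]. *)
pose N : R := n%:R ^+ 2 + 1; have Nn : 0 <= n%:R ^+ 2 :> R by rewrite exprn_ge0.
have N0 : 0 < N by rewrite /N; lra.
pose e := th / (2 * N).
have e0 : 0 < e by rewrite divr_gt0 // mulr_gt0.
have nearH : \forall x \near z0, forall i j, `|hessian f x i j - hessian f z0 i j| <= e.
  have := @near_coords (fun i j => partial j (partial i f)) z0 e e0
    (fun i j => cddf i j z0 (nbhs_singleton Uz0)).
  by apply: filterS => x Hx i j; rewrite !mxE; exact: Hx.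
have [d /= d0 dB] := (nbhs_ballP _ _).1 (filterI Uz0 nearH).
have inU x : `|x - z0| < d -> U x /\ forall i j, `|hessian f x i j - hessian f z0 i j| <= e.
  by move=> xd; apply: dB; rewrite -ball_normE /ball_ /= distrC.
pose M := \sum_i \sum_j `|hessian f z0 i j| + e.
have MH x i j : `|x - z0| < d -> `|hessian f x i j| <= M.
  move=> /inU[_ /(_ i j) H]; rewrite -[hessian f x i j](subrK (hessian f z0 i j)) addrC.
  apply: le_trans (ler_normD _ _) _; rewrite lerD //.
  rewrite (bigD1 i) //= (bigD1 j) //= -addrA lerDl addr_ge0 // ?sumr_ge0 //.
  by move=> k _; rewrite sumr_ge0.
have M0 : 0 <= M by rewrite addr_ge0 ?(ltW e0) // sumr_ge0 // => i _; rewrite sumr_ge0.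
pose th' := th / (2 * N).
have quad x v : `|x - z0| < d -> th' * enorm v ^+ 2 <= dot (v *m hessian f x) v.
  move=> /inU[_ /quad_perturb H]; apply: le_trans (H v).
  have ev : enorm v ^+ 2 <= N * `|v| ^+ 2.
    have := enorm_le_norm v; rewrite -(@ler_pXn2r _ 2) ?nnegrE ?mulr_ge0 ?enorm_ge0 //.
    by rewrite exprMn /N mulrDl mul1r => /le_trans; apply; rewrite lerDl exprn_ge0.
  have thN : th' * N = th / 2 by rewrite /th'; field; rewrite gt_eqF.
  have : th' * enorm v ^+ 2 <= th / 2 * `|v| ^+ 2.
    by rewrite -thN -mulrA ler_pM2l.
  have : n%:R ^+ 2 * e * `|v| ^+ 2 <= th / 2 * `|v| ^+ 2.
    by rewrite ler_wpM2r ?exprn_ge0 // -thN -/e mulrC /th' -/e ler_pM2l // /N lerDl.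
  have := thH v; lra.
(* One factor [n] converts [enorm] to the maximum norm, the other comes from [dot_le_norm]; halving
   [d] puts the closed ball inside the open one. *)
exists (d / 2), th', (n%:R * (n%:R * M)).
have sup_ball x : eball z0 (d / 2) x -> `|x - z0| < d.
  by move=> xb; apply: le_lt_trans (norm_le_enorm _) _; apply: le_lt_trans xb _; lra.
split => //; first by rewrite divr_gt0.
- by rewrite !mulr_ge0.
- by move=> x /sup_ball /inU[].
move=> a b /sup_ball ad /sup_ball bd.
have seg t : 0 <= t <= 1 -> `|b + t *: (a - b) - z0| < d.
  by move=> t01; exact: segment_ball.
split.
  apply: le_trans (enorm_le_norm _) _; rewrite -!mulrA ler_wpM2l //.
  apply: norm_leP => [|i]; first by rewrite !mulr_ge0 // enorm_ge0.
  rewrite !mxE.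
  have [|t t01 ->] := @mvt_line (partial i f) a b.
    by move=> t t01; apply: ddf; have [] := inU _ (seg t t01).
  have ct : `|b + t *: (a - b) - z0| < d by apply: seg; case/andP: t01 => *; rewrite !ltW.
  apply: le_trans (dot_le_norm _ _) _; rewrite ler_wpM2l //.
  rewrite ler_pM ?norm_le_enorm //; apply: norm_leP => // j.
  by rewrite mxE; have := MH _ i j ct; rewrite mxE.
pose v := a - b; pose E := enorm v ^+ 2.
have key t : 0 <= t <= 1 -> t * (th' * E) <= dot (grad f (b + t *: v)) v - dot (grad f b) v.
  move=> t01; pose phi := fun x => dot v (grad f x).
  have tv : b + t *: v - b = t *: v by rewrite addrAC subrr add0r.
  have sg s : 0 <= s <= 1 -> `|b + s *: (b + t *: v - b) - z0| < d.
    by move=> s01; apply: segment_ball => //; exact: seg.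
  have dphi c : `|c - z0| < d -> differentiable phi c /\
      dot (grad phi c) v = dot (v *m hessian f c) v.
    by move=> /inU[Uc _]; apply: quad_grad => i; exact: ddf.
  have [|s s01] := @mvt_line phi (b + t *: v) b.
    by move=> s s01; have [] := dphi _ (sg s s01).
  have cs : `|b + s *: (b + t *: v - b) - z0| < d.
    by apply: sg; case/andP: s01 => *; rewrite !ltW.
  rewrite /phi !(dotC v) => ->; rewrite tv dotZr; move: cs; rewrite tv => cs.
  rewrite (dphi _ cs).2 ler_wpM2l //; first by case/andP: t01.
  exact: quad.
(* By [key] this difference from the quadratic model has nonnegative derivative; comparing its
   values at 0 and 1 gives the claim. *)
pose g (t : R) := f (b + t *: v) - (t * dot (grad f b) v + th' * E / 2 * t ^+ 2).
have dg (t : R) : 0 <= t <= 1 ->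
    is_derive t 1 g (dot (grad f (b + t *: v)) v - (dot (grad f b) v + t * (th' * E))).
  move=> t01; apply: is_deriveB.
    by apply: is_derive_line; apply: df; have [] := inU _ (seg t t01).
  exact: is_derive_quadratic.
have [|||t] := @MVT R g
    (fun t => dot (grad f (b + t *: v)) v - (dot (grad f b) v + t * (th' * E))) 0 1.
- exact: ltr01.
- by move=> t; rewrite in_itv /= => /andP[t0 t1]; apply: dg; rewrite !ltW.
- apply: derivable_within_continuous => t; rewrite in_itv /= => t01.
  by have := dg t t01; case.
rewrite in_itv /= => /andP[t0 t1]; rewrite subr0 mulr1 /g.
rewrite scale1r scale0r addr0 [b + v]addrC subrK => H.
have := key t; rewrite (ltW t0) (ltW t1) => /(_ isT).
by move: H; rewrite -/v -/E expr1n expr0n /=; lra.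
Qed.
End LocalC2.

(** * Contraction factors and one step of the algorithm *)

Section Rate.
Context {R : realType}.
Implicit Types (rho sigma kappa theta Theta : R).

Lemma Ck_gt0 rho sigma kappa theta Theta : 0 < sigma -> 0 < kappa ->
  0 < theta -> 0 < Theta -> 0 < Ck rho sigma kappa theta Theta.
Proof.
move=> s0 k0 t0 T0; rewrite /Ck mulr_gt0 ?divr_gt0 // exprn_gt0 //.
apply: ltr_wpDl; first by rewrite divr_ge0 ?mulr_ge0 ?sqrtr_ge0.
by rewrite !mulr_gt0 ?invr_gt0 // ltr_wpDr ?sqrtr_ge0.
Qed.

Lemma qk_in01 rho sigma kappa theta Theta : rho < 1 -> 0 < sigma -> 0 < kappa ->
  0 < theta -> 0 < Theta -> 0 < qk rho sigma kappa theta Theta < 1.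
Proof.
move=> r1 s0 k0 t0 T0; have C0 := Ck_gt0 rho s0 k0 t0 T0.
have q0 : 0 < (1 - rho) / Ck rho sigma kappa theta Theta by rewrite divr_gt0 ?subr_gt0.
rewrite /qk; apply/andP; split; first by rewrite divr_gt0 // addr_gt0.
by rewrite ltr_pdivrMr ?addr_gt0 // mul1r ltrDl.
Qed.

(** In the application [dz], [dz'] and [wn] are the norms of [p - z], [p - zp] and [w], [D] is
    [brD p z], and [A] bounds the distance from [zp] to the zeros up to an arbitrarily small
    error. *)
Lemma Ck_bound rho sigma kappa theta Theta (D dz dz' wn A : R) :
  0 <= rho -> 0 < sigma -> 0 < kappa -> 0 < theta -> theta <= Theta ->
  0 <= dz -> 0 <= dz' -> 0 <= A ->
  theta / 2 * dz ^+ 2 <= D -> theta / 2 * dz' ^+ 2 <= rho * D ->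
  sigma * wn <= Theta * (dz + dz') -> A <= dz' + kappa * wn ->
  Theta / 2 * A ^+ 2 <= Ck rho sigma kappa theta Theta * D.
Proof.
move=> r0 s0 k0 t0 tT dz0 dz'0 A0 H1 H2 H3 H4.
have T0 : 0 < Theta by exact: lt_le_trans tT.
have D0 : 0 <= D by apply: le_trans H1; rewrite mulr_ge0 ?exprn_ge0 // divr_ge0 // ltW.
pose S := Num.sqrt (2 * D / theta).
have S0 : 0 <= S by exact: sqrtr_ge0.
have S2 : S ^+ 2 = 2 * D / theta by rewrite sqr_sqrtr // divr_ge0 ?mulr_ge0 // ltW.
have sr0 : 0 <= Num.sqrt rho by exact: sqrtr_ge0.
have dzS : dz <= S.
  rewrite -(@ler_pXn2r _ 2) ?nnegrE // S2 ler_pdivlMr //; lra.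
have dz'S : dz' <= Num.sqrt rho * S.
  rewrite -(@ler_pXn2r _ 2) ?nnegrE ?mulr_ge0 // exprMn S2 sqr_sqrtr //.
  by rewrite mulrA ler_pdivlMr //; lra.
(* The first term of [Ck] carries this factor; being at least 1, it only weakens the bound on
   [dz']. *)
have sT : 1 <= Num.sqrt Theta / Num.sqrt theta.
  by rewrite ler_pdivlMr ?sqrtr_gt0 // mul1r ler_wsqrtr.
pose B := Num.sqrt rho * Num.sqrt Theta / Num.sqrt theta
   + kappa / sigma * Theta * (1 + Num.sqrt rho).
have AB : A <= B * S.
  apply: le_trans H4 _; rewrite /B mulrDl lerD //.
    apply: le_trans dz'S _; rewrite ler_wpM2r // -mulrA ler_peMr //.
  apply: (@le_trans _ _ (kappa * (Theta * (dz + dz') / sigma))).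
    by rewrite ler_pM2l // ler_pdivlMr // mulrC.
  have -> : kappa / sigma * Theta * (1 + Num.sqrt rho) * S =
            kappa * (Theta * (S + Num.sqrt rho * S) / sigma) by ring.
  by rewrite ler_pM2l // ler_pM2r ?invr_gt0 // ler_pM2l // lerD.
have -> : Ck rho sigma kappa theta Theta * D = Theta / 2 * (B * S) ^+ 2.
  by rewrite exprMn S2 /Ck -/B; field; rewrite gt_eqF.
by rewrite ler_pM2l ?divr_gt0 // ler_pXn2r ?nnegrE // (le_trans A0).
Qed.

Lemma qk_cvg0 (sigma rho : nat -> R) (rho0 kappa theta Theta : R) :
  rho0 < 1 -> (forall k, 0 <= rho k <= rho0) -> (forall k, 0 < sigma k) ->
  0 < kappa -> 0 < theta -> 0 < Theta ->
  sigma @ \oo --> +oo -> rho @ \oo --> 0 ->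
  (fun k => qk (rho k) (sigma k) kappa theta Theta) @ \oo --> 0.
Proof.
move=> r1 rk sk k0 t0 T0 sy r0.
have sr0 : (fun k => Num.sqrt (rho k)) @ \oo --> (0 : R).
  rewrite -[X in _ --> X](sqrtr0 R); apply: continuous_cvg r0; exact: sqrt_continuous.
have si0 : (fun k => (sigma k)^-1) @ \oo --> (0 : R).
  by apply/gtr0_cvgV0 => //; exact: nearW.
have C0 : (fun k => Ck (rho k) (sigma k) kappa theta Theta / (1 - rho0)) @ \oo --> (0 : R).
  have -> : (0 : R) = (0 * Num.sqrt Theta / Num.sqrt theta
     + kappa * 0 * Theta * (1 + 0)) * (0 * Num.sqrt Theta / Num.sqrt theta
     + kappa * 0 * Theta * (1 + 0)) * (Theta / theta) / (1 - rho0) by ring.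
  rewrite /Ck; under eq_fun do rewrite expr2.
  apply: cvgM; last exact: cvg_cst.
  apply: cvgM; last exact: cvg_cst.
  have H : (fun k => Num.sqrt (rho k) * Num.sqrt Theta / Num.sqrt theta
     + kappa / sigma k * Theta * (1 + Num.sqrt (rho k))) @ \oo -->
     (0 * Num.sqrt Theta / Num.sqrt theta + kappa * 0 * Theta * (1 + 0) : R).
    apply: cvgD.
      by apply: cvgM; [apply: cvgM; [exact: sr0|exact: cvg_cst]|exact: cvg_cst].
    apply: cvgM; last by apply: cvgD; [exact: cvg_cst|exact: sr0].
    by apply: cvgM; [apply: cvgM; [exact: cvg_cst|exact: si0]|exact: cvg_cst].
  exact: (cvgM H H).
(* [qk] lies between 0 and [Ck / (1 - rho0)], because [1 - rho k >= 1 - rho0]. *)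
apply: squeeze_cvgr (cvg_cst 0) C0; apply: nearW => k.
have /andP[rk0 rkr] := rk k.
have rk1 : rho k < 1 by exact: le_lt_trans r1.
have /andP[q0 _] := qk_in01 rk1 (sk k) k0 t0 T0.
rewrite ltW //=.
have Cp := Ck_gt0 (rho k) (sk k) k0 t0 T0.
rewrite /qk; set C := Ck _ _ _ _ _.
have r0p : 0 < 1 - rho0 by rewrite subr_gt0.
have -> : C / (1 - rho0) = 1 / ((1 - rho0) / C).
  by field; rewrite !gt_eqF.
have pB : 0 < (1 - rho0) / C by rewrite divr_gt0.
have pA : 0 < 1 + (1 - rho k) / C by rewrite addr_gt0 // divr_gt0 // subr_gt0.
rewrite ler_pM2l // lef_pV2 ?posrE //.
apply: le_trans (_ : (1 - rho k) / C <= _); last by rewrite lerDr.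
by rewrite ler_pM2r ?invr_gt0 // lerB.
Qed.
End Rate.

Lemma cvg_enorm {R : realType} {n : nat} (u : nat -> 'rV[R]_n) (l : 'rV[R]_n) (s : R) :
  u @ \oo --> l -> 0 < s -> exists N : nat, forall k, (N <= k)%N -> enorm (u k - l) <= s.
Proof.
move=> /cvgrPdist_le ul s0.
have p0 : 0 < n%:R + 1 :> R by rewrite ltr_wpDl.
have [N _ H] := ul (s / (n%:R + 1)) (divr_gt0 s0 p0).
exists N => k Nk; have := H k Nk; rewrite /= distrC ler_pdivlMr // => Hk.
apply: le_trans (enorm_le_norm _) (le_trans _ Hk).
by rewrite mulrC ler_wpM2l // lerDl.
Qed.

Section Step.
Context {R : realType} {n : nat} (Phi : 'rV[R]_n -> \bar R).
Context (Pp : proper_fun Phi) (Pc : convex_fun Phi).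
Context (Pd : forall x, intdom Phi x -> differentiable (finPhi Phi) x).
Implicit Types (x y z p w : 'rV[R]_n) (Z : set 'rV[R]_n).

Lemma brD_step x p z zp w (sigma rho : R) : 0 <= sigma -> 0 <= dot w (p - x) ->
  gradPhi Phi zp = gradPhi Phi z - sigma *: w -> brD Phi p zp <= rho * brD Phi p z ->
  brD Phi x zp + (1 - rho) * brD Phi p z <= brD Phi x z.
Proof.
move=> s0 wpx Gzp Hp.
(* All values of [Phi] cancel, and only the gradient increment [sigma *: w] survives. *)
have : brD Phi x z - brD Phi x zp - (brD Phi p z - brD Phi p zp) = sigma * dot w (p - x).
  by rewrite /brD Gzp !dotBl !dotBr !dotZl; ring.
have := mulr_ge0 s0 wpx; lra.
Qed.

(** A point of [Z] in the domain bounds the infimum above, nonnegativity of [brD] bounds it below;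
    the distance can then be treated as a real number. *)
Lemma dist_Phi_fin z x Z : intdom Phi z -> edom Phi x -> Z x ->
  dist_Phi Phi z Z = (fine (dist_Phi Phi z Z))%:E.
Proof.
move=> zi xd Zx; have zd := intdom_edom zi.
have le1 : (dist_Phi Phi z Z <= (brD Phi x z)%:E)%E.
  by rewrite -(BregmanE xd zi); apply: ereal_inf_lbound; exists x.
have ge0 : (0 <= dist_Phi Phi z Z)%E.
  apply: le_ereal_inf_tmp => _ [y _ <-]; rewrite /Bregman.
  case: asboolP => [[yd _]|_]; last by rewrite leey.
  by rewrite lee_fin; exact: brD_ge0 (Pd zi).
by move: le1 ge0; case: (dist_Phi _ _ _).
Qed.

(* The contraction q is the reciprocal of 1 + (1 - rho)/C, so it suffices to
   bound every [brD x z] below by [l + (1 - rho) * (l / C)]. *)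
Lemma dist_Phi_contract z zp Z (l D rho C : R) : 0 < C -> rho < 1 ->
  intdom Phi z -> intdom Phi zp -> dist_Phi Phi zp Z = l%:E -> l <= C * D ->
  (forall x, Z x -> edom Phi x -> brD Phi x zp + (1 - rho) * D <= brD Phi x z) ->
  (dist_Phi Phi zp Z <= (1 / (1 + (1 - rho) / C))%:E * dist_Phi Phi z Z)%E.
Proof.
move=> C0 r1 zi zpi dl lC H.
have m0 : 0 < 1 + (1 - rho) / C by rewrite addr_gt0 // divr_gt0 ?subr_gt0.
have lo : ((l * (1 + (1 - rho) / C))%:E <= dist_Phi Phi z Z)%E.
  apply: le_ereal_inf_tmp => _ [x Zx <-]; rewrite /Bregman.
  case: asboolP => [[xd _]|_]; last by rewrite leey.
  rewrite lee_fin -/(gradPhi Phi) -/(brD Phi x z); apply: le_trans (H x Zx xd).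
  have : (dist_Phi Phi zp Z <= (brD Phi x zp)%:E)%E.
    by rewrite -(BregmanE xd zpi); apply: ereal_inf_lbound; exists x.
  rewrite dl lee_fin => lx.
  have : (1 - rho) * (l / C) <= (1 - rho) * D.
    by rewrite ler_wpM2l ?subr_ge0 ?(ltW r1) // ler_pdivrMr // mulrC.
  rewrite mulrDr mulr1 mulrCA; lra.
have -> : dist_Phi Phi zp Z =
    ((1 / (1 + (1 - rho) / C))%:E * (l * (1 + (1 - rho) / C))%:E)%E.
  by rewrite dl -EFinM mul1r mulrCA mulVf ?mulr1 // gt_eqF.
by apply: lee_wpmul2l lo; rewrite lee_fin divr_ge0 // ltW.
Qed.
End Step.

(** * Local analysis of the iteration *)

Section Proximal.
Context {R : realType} {n : nat} (Phi : 'rV[R]_n -> \bar R).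
Context (Pp : proper_fun Phi) (Pc : convex_fun Phi).
Context (Pd : forall x, intdom Phi x -> differentiable (finPhi Phi) x).
Context (c : 'rV[R]_n) (r th L : R).
Context (th0 : 0 < th) (L0 : 0 <= L) (rI : eball c r `<=` intdom Phi).
Context (gradL : forall a b, eball c r a -> eball c r b ->
  enorm (gradPhi Phi a - gradPhi Phi b) <= L * enorm (a - b)).
Context (brD_ge : forall a b, eball c r a -> eball c r b ->
  th / 2 * enorm (a - b) ^+ 2 <= brD Phi a b).

Lemma brD_le_sqr a b : eball c r a -> eball c r b ->
  brD Phi a b <= L * enorm (a - b) ^+ 2.
Proof.
move=> ar br; apply: le_trans (brD_le_dot Pp Pc _ _ _) _.
- exact/intdom_edom/rI.
- exact/intdom_edom/rI.
- exact/Pd/rI.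
apply: le_trans (dot_le_enorm _ _) _.
by rewrite expr2 mulrA ler_wpM2r ?enorm_ge0 // gradL.
Qed.

(* If [p] stayed at distance at least [eta / 2] from [zp], convexity would make
   [brD p zp] grow linearly in that distance, whereas the three-point identity
   and [brD p zp <= rho * brD p z] only allow growth with slope O(s). *)
Lemma brD_prox_near (rho0 eta : R) : rho0 < 1 -> 0 < eta <= r ->
  exists2 s : R, 0 < s & forall z zp p (rho : R), 0 <= rho <= rho0 ->
    enorm (z - c) <= s -> enorm (zp - c) <= s -> edom Phi p ->
    brD Phi p zp <= rho * brD Phi p z -> enorm (p - c) <= eta.
Proof.
move=> rho1 /andP[eta0 etar].
pose r1 := eta / 2; have r10 : 0 < r1 by rewrite divr_gt0.
(* [K] is the growth slope of [brD p zp] discounted by [1 - rho0]; [s] is chosen to make the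
   opposing slope [6 * L * s], the sum of those in [B1] and [B2], smaller. Using [L + 1] covers
   [L = 0]. *)
pose K := (1 - rho0) * (th / 2 * r1).
have K0 : 0 < K by rewrite mulr_gt0 ?subr_gt0 // mulr_gt0 // divr_gt0.
have L6 : 0 < 6 * (L + 1) by rewrite mulr_gt0 // ltr_wpDl.
pose s := Num.min r1 (K / (6 * (L + 1))).
have s0 : 0 < s by rewrite lt_min r10 divr_gt0.
have sr1 : s <= r1 by rewrite ge_min lexx.
have sK : 6 * (L * s) < K.
  have : s <= K / (6 * (L + 1)) by rewrite ge_min lexx orbT.
  by rewrite ler_pdivlMr //; lra.
have rE : eta = 2 * r1 by rewrite /r1; field.
exists s => // z zp p rho /andP[rho_ge0 rhole] zs zps pd Hp.
have zr : eball c r z by rewrite /eball /=; lra.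
have zpr : eball c r zp by rewrite /eball /=; lra.
have zpd := intdom_edom (rI zpr).
have zzp : enorm (zp - z) <= 2 * s.
  by have := enorm_triangle zp c z; rewrite (enormB c z); lra.
have [pr1|pr1] := lerP (enorm (p - zp)) r1.
  by have := enorm_triangle p zp c; lra.
exfalso; set d := enorm (p - zp) in pr1.
have G : th / 2 * r1 * d <= brD Phi p zp.
  apply: (brD_growth Pp Pc) => //; last exact: ltW.
  move=> q qd qr1; apply: brD_ge => //; rewrite /eball /=.
  by have := enorm_triangle q zp c; lra.
have T := brD_three_point Phi p zp z.
have d0 : 0 < d by exact: lt_trans pr1.
(* One factor of the square is at most [2 * s], the other at most [2 * d] since [s <= r1 < d]; this
   leaves a term linear in [d]. *)
have B1 : brD Phi zp z <= 4 * L * s * d.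
  apply: le_trans (brD_le_sqr zpr zr) _.
  have : enorm (zp - z) ^+ 2 <= (2 * s) * (2 * d).
    by rewrite expr2 ler_pM ?enorm_ge0 //; lra.
  by move=> /(ler_wpM2l L0); lra.
have B2 : dot (gradPhi Phi zp - gradPhi Phi z) (p - zp) <= 2 * L * s * d.
  apply: le_trans (dot_le_enorm _ _) _; rewrite ler_wpM2r ?enorm_ge0 //.
  apply: le_trans (gradL zpr zr) _.
  by have := ler_wpM2l L0 zzp; lra.
have D0 : 0 <= brD Phi p zp by exact: (brD_ge0 Pp Pc pd zpd (Pd (rI zpr))).
have Ls0 : 0 <= 6 * L * s * d by rewrite !mulr_ge0 // ltW.
have H1 : brD Phi p zp <= rho0 * brD Phi p zp + 6 * L * s * d.
  have H2 : rho * brD Phi p z <= rho * (brD Phi p zp + 6 * L * s * d).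
    by rewrite ler_wpM2l //; lra.
  have H3 : rho * brD Phi p zp <= rho0 * brD Phi p zp by rewrite ler_wpM2r.
  have H4 : rho * (6 * L * s * d) <= 1 * (6 * L * s * d).
    by rewrite ler_wpM2r //; lra.
  lra.
have H5 : K * d <= 6 * (L * s) * d.
  have : (1 - rho0) * (th / 2 * r1 * d) <= (1 - rho0) * brD Phi p zp.
    by rewrite ler_wpM2l // subr_ge0 ltW.
  by rewrite /K; lra.
by move: H5; rewrite ler_pM2r // leNgt sK.
Qed.
End Proximal.

(** * Local linear rate and superlinear convergence *)

Theorem mainTheorem8 (R : realType) (n : nat)
    (Phi : 'rV[R]_n -> \bar R) (T : 'rV[R]_n -> set 'rV[R]_n)
    (sigma rho : nat -> R) (sigma0 rho0 : R)
    (z p w : nat -> 'rV[R]_n) (zstar zinf : 'rV[R]_n) (delta kappa : R) :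
  Legendre Phi ->
  C2_on (finPhi Phi) (intdom Phi) ->
  very_strictly_convex Phi ->
  maximal_monotone T ->
  intdom Phi `&` dom_op T !=set0 ->
  0 < sigma0 -> (forall k, sigma0 <= sigma k) ->
  rho0 < 1 -> (forall k, 0 <= rho k <= rho0) ->
  iBPPA Phi T sigma rho z p w ->
  zer T `&` intdom Phi !=set0 ->
  edom Phi zstar -> zer T zstar -> coercive (Bregman Phi zstar) ->
  z @ \oo --> zinf -> zer T zinf -> intdom Phi zinf ->
  0 < delta -> 0 < kappa -> EB T zinf delta kappa ->
  exists eps theta Theta : R,
    [/\ 0 < eps, 0 < theta,
        eball zinf eps `<=` intdom Phi,
        (forall a b, eball zinf eps a -> eball zinf eps b ->
           enorm (gradPhi Phi a - gradPhi Phi b) <= Theta * enorm (a - b)) &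
        (forall a b, eball zinf eps a -> eball zinf eps b ->
           ((theta / 2 * enorm (a - b) ^+ 2)%:E <= Bregman Phi a b)%E)] /\
        (exists k0 : nat, forall k, (k0 <= k)%N ->
           0 < qk (rho k) (sigma k) kappa theta Theta < 1 /\
           (dist_Phi Phi (z k.+1) (zer T)
              <= (qk (rho k) (sigma k) kappa theta Theta)%:E
                 * dist_Phi Phi (z k) (zer T))%E) /\
        (sigma @ \oo --> +oo -> rho @ \oo --> 0 ->
           (fun k => qk (rho k) (sigma k) kappa theta Theta) @ \oo --> 0).
Proof.
move=> [[Pp Pl Pc] [_ Pd _] Ps] C2 vsc [Tmono _] _ sig0 sigk rho1 rhok [z0i iter]
  _ _ _ _ zcv zerinf infi delta0 kappa0 HEB.
have infn : nbhs zinf (intdom Phi) by exact: nbhs_interior.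
have [r [th [L [r0 th0 L0 rI loc]]]] := C2_local_bounds infn C2 (vsc zinf infi).
have gradL a b ar br := (loc a b ar br).1.
have brD_ge a b ar br : th / 2 * enorm (a - b) ^+ 2 <= brD Phi a b := (loc a b ar br).2.
(* [L <= Th / 2] serves the quadratic upper bound and [th <= Th] serves [Ck_bound]; the summand [th]
   keeps [Th] positive when [L = 0]. *)
have [Th Th0 [LTh L2 thTh]] : exists2 Th : R, 0 < Th &
    [/\ L <= Th, L <= Th / 2 & th <= Th].
  by exists (2 * L + th); [lra|split; lra].
have skp k : 0 < sigma k by exact: lt_le_trans (sigk k).
have rk1 k : rho k < 1 by case/andP: (rhok k) => _ h; exact: le_lt_trans rho1.
have rk0 k : 0 <= rho k by case/andP: (rhok k).
have zi k : intdom Phi (z k).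
  by case: k => [|k]; [exact: z0i | have [[_ _ _ _ zk1] _] := iter k; exact: zk1].
exists r, th, Th; split; [split => //|split].
- move=> a b ar br; apply: le_trans (gradL a b ar br) _.
  by rewrite ler_wpM2r ?enorm_ge0.
- move=> a b ar br; rewrite (BregmanE (intdom_edom (rI _ ar)) (rI _ br)) lee_fin.
  exact: brD_ge.
- have step k : gradPhi Phi (z k.+1) = gradPhi Phi (z k) - sigma k *: w k /\
      brD Phi (p k) (z k.+1) <= rho k * brD Phi (p k) (z k).
    have [[pd _ yi zE zpi] Hk] := iter k; split.
      by rewrite zE (gradK_conjugate Pp Pc Pl Ps Pd yi) // -zE.
    by rewrite (BregmanE pd zpi) (BregmanE pd (zi k)) -EFinM lee_fin in Hk; exact: Hk.
  (* Three displacements of at most [eta] must fit in radius [r]: from [zinf] to [p k], the error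
     bound [kappa * enorm (w k)], and the excess [e] of a nearly closest zero. *)
  pose eta := r / 4; have eta0 : 0 < eta by rewrite divr_gt0.
  pose eta' := Num.min eta delta.
  have etab : 0 < eta' <= r.
    by rewrite lt_min eta0 delta0 /= ge_min /eta; apply/orP; left; lra.
  have [s s0 sP] := brD_prox_near Pp Pc Pd th0 L0 rI gradL brD_ge rho1 etab.
  pose wmax := Num.min delta (eta / kappa).
  have wmax0 : 0 < wmax by rewrite lt_min delta0 divr_gt0.
  (* For iterates within [s'] of [zinf], the gradient difference [sigma k *: w k] has norm at most
     [2 * Th * s'], so the last bound forces [enorm (w k) <= wmax]. *)
  pose s' := Num.min (Num.min s eta) (wmax * sigma0 / (2 * Th)).
  have s'0 : 0 < s' by rewrite !lt_min s0 eta0 divr_gt0 // mulr_gt0.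
  have s's : s' <= s by rewrite !ge_min lexx.
  have s'eta : s' <= eta by rewrite !ge_min lexx orbT.
  have s'w : s' * (2 * Th) <= wmax * sigma0.
    by rewrite -ler_pdivlMr ?mulr_gt0 // ge_min lexx orbT.
  have [k0 k0P] := cvg_enorm zcv s'0.
  exists k0 => k kk0; split; first exact: qk_in01.
  have zs := k0P k kk0; have zps := k0P k.+1 (leqW kk0).
  have [Gz Hp] := step k; have [[pd Tpw _ _ _] _] := iter k.
  have pc : enorm (p k - zinf) <= eta'.
    by apply: sP Hp => //; [exact: le_trans s's|exact: le_trans s's].
  have inball x : enorm (x - zinf) <= 3 * eta -> eball zinf r x.
    by rewrite /eball /= /eta => h; lra.
  have pb : eball zinf r (p k) by apply: inball; move: pc; rewrite le_min => /andP[]; lra.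
  have zb : eball zinf r (z k) by apply: inball; lra.
  have zpb : eball zinf r (z k.+1) by apply: inball; lra.
  have sw : sigma k * enorm (w k) <= Th * (enorm (p k - z k) + enorm (p k - z k.+1)).
    have -> : sigma k * enorm (w k) = enorm (gradPhi Phi (z k) - gradPhi Phi (z k.+1)).
      by rewrite Gz opprB addrCA subrr addr0 enormZ gtr0_norm.
    apply: le_trans (gradL _ _ zb zpb) _.
    apply: ler_pM => //; first exact: enorm_ge0.
    by rewrite (enormB (p k) (z k)); exact: enorm_triangle.
  have ww : enorm (w k) <= wmax.
    have : sigma k * enorm (w k) <= Th * (2 * s').
      have -> : sigma k * enorm (w k) = enorm (gradPhi Phi (z k) - gradPhi Phi (z k.+1)).
        by rewrite Gz opprB addrCA subrr addr0 enormZ gtr0_norm.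
      apply: le_trans (gradL _ _ zb zpb) _; apply: ler_pM => //; first exact: enorm_ge0.
      by have := enorm_triangle (z k) zinf (z k.+1); rewrite (enormB zinf); lra.
    have : sigma0 * enorm (w k) <= sigma k * enorm (w k).
      by rewrite ler_wpM2r ?enorm_ge0.
    by move=> h1 h2; rewrite -(ler_pM2l sig0); lra.
  have [wdelta weta] : enorm (w k) <= delta /\ kappa * enorm (w k) <= eta.
    by move: ww; rewrite le_min ler_pdivlMr // mulrC => /andP.
  have pdelta : enorm (p k - zinf) <= delta by move: pc; rewrite le_min => /andP[].
  have peta : enorm (p k - zinf) <= eta by move: pc; rewrite le_min => /andP[].
  have HE := HEB _ _ Tpw pdelta wdelta.
  have infd := intdom_edom infi.
  have dl := dist_Phi_fin Pp Pc Pd (zi k.+1) infd zerinf.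
  set l := fine _ in dl.
  pose A := enorm (p k - z k.+1) + kappa * enorm (w k).
  have A0 : 0 <= A by rewrite addr_ge0 ?enorm_ge0 // mulr_ge0 ?enorm_ge0 // ltW.
  have near_zero (e : R) : 0 < e <= eta -> l <= Th / 2 * (A + e) ^+ 2.
    move=> /andP[e0 ee].
    have [x Tx xp] : exists2 x, zer T x & enorm (p k - x) < kappa * enorm (w k) + e.
      have : (Defs.edist (p k) (zer T) < (kappa * enorm (w k) + e)%:E)%E.
        by apply: le_lt_trans HE _; rewrite lte_fin ltrDl.
      by move=> /ereal_inf_lt[_ [x Tx <-]]; rewrite lte_fin => ?; exists x.
    have xb : eball zinf r x.
      apply: inball; have := enorm_triangle x (p k) zinf.
      by rewrite (enormB x (p k)); lra.
    have : (dist_Phi Phi (z k.+1) (zer T) <= (brD Phi x (z k.+1))%:E)%E.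
      rewrite -(BregmanE (intdom_edom (rI _ xb)) (zi k.+1)).
      by apply: ereal_inf_lbound; exists x.
    rewrite dl lee_fin => /le_trans; apply.
    apply: le_trans (brD_le_sqr Pp Pc Pd rI gradL xb zpb) _.
    apply: ler_pM => //; first by rewrite exprn_ge0 ?enorm_ge0.
    have Ae0 : 0 <= A + e by rewrite addr_ge0 // ltW.
    rewrite ler_pXn2r ?nnegrE ?enorm_ge0 //.
    have := enorm_triangle x (p k) (z k.+1); rewrite (enormB x (p k)) /A; lra.
  have lA : l <= Th / 2 * A ^+ 2.
    apply/ler_addgt0Pr => t t0.
    (* For [m <= 1] the square of [A + m] exceeds that of [A] by at most [m * (2 * A + 1)]; the last
       bound makes this excess cost at most [t]. *)
    pose m := Num.min (Num.min eta 1) (t / (Th / 2 * (2 * A + 1))).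
    have M0 : 0 < Th / 2 * (2 * A + 1) by rewrite mulr_gt0 ?divr_gt0 // ltr_wpDl // mulr_ge0.
    have m0 : 0 < m by rewrite !lt_min eta0 ltr01 divr_gt0.
    have meta : m <= eta by rewrite !ge_min lexx.
    have m1 : m <= 1 by rewrite !ge_min lexx orbT.
    have me : m * (Th / 2 * (2 * A + 1)) <= t.
      by rewrite -ler_pdivlMr // ge_min lexx orbT.
    have := near_zero m; rewrite m0 meta => /(_ isT) h; apply: le_trans h _.
    have : Th / 2 * m ^+ 2 <= Th / 2 * m.
      by rewrite ler_pM2l ?divr_gt0 // expr2 ler_piMr // ltW.
    by rewrite sqrrD; lra.
  have D0 : 0 <= brD Phi (p k) (z k).
    exact: (brD_ge0 Pp Pc pd (intdom_edom (zi k)) (Pd _ (zi k))).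
  apply: (dist_Phi_contract (D := brD Phi (p k) (z k)) _ (rk1 k) (zi k) (zi k.+1) dl).
  + exact: Ck_gt0.
  + apply: le_trans lA _.
    apply: (@Ck_bound _ _ _ _ _ _ _ (enorm (p k - z k)) (enorm (p k - z k.+1)) (enorm (w k))) => //.
    * exact: enorm_ge0.
    * exact: enorm_ge0.
    * exact: brD_ge.
    * by apply: le_trans Hp; exact: brD_ge.
  + move=> x Tx xd; apply: (brD_step _ _ Gz Hp); first exact: ltW.
    by have := Tmono _ _ _ _ Tpw Tx; rewrite subr0.
- by move=> sy r00; apply: (qk_cvg0 rho1).
Qed.
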